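(* Let $G$ be a graph, let $k\ge 1$ be an integer, and let $S_1$ and $S_2$ be two disjoint subsets of $V(G)$ such that $S_1$ and $S_2$ are $k$-linked. If each $S_i$ has a subset $T_i$ of size $k-1$, for $i\in\{1,2\}$, such that $T_1$ and $T_2$ are $(k-1)$-linked, then there is a vertex $s_i\in S_i\setminus T_i$ for each $i\in\{1,2\}$ such that $T_1\cup\{s_1\}$ and $T_2\cup\{s_2\}$ are $k$-linked.
   Context: Graphs are finite and simple. For an integer $m\ge 0$, two disjoint vertex subsets $A_1$ and $A_2$ of a graph $G$ are $m$-linked (in $G$) if there exist $m$ pairwise vertex-disjoint paths in $G$ joining $m$ distinct vertices of $A_1$ to $m$ distinct vertices of $A_2$ such that each of the $m$ paths meets $A_i$ in exactly one vertex for each $i\in\{1,2\}$. *)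

(* Defs.v *)
From mathcomp Require Import all_boot.

Set Implicit Arguments.
Unset Strict Implicit.
Unset Printing Implicit Defensive.

Section Linkage.

Variables (V : finType) (e : rel V).

(* [x :: p] is the vertex sequence of a path of the graph starting at [x] and
   ending at [last x p]; a one-vertex path is allowed. *)
Definition gpath (x : V) (p : seq V) : bool := path e x p && uniq (x :: p).

(* The [i]-th path is [x i :: p i].  The definition is only meant for disjoint
   [A1] and [A2]; disjointness is not part of the predicate. *)
Definition linked (m : nat) (A1 A2 : {set V}) : Prop :=
  exists (x : 'I_m -> V) (p : 'I_m -> seq V),
    [/\ forall i, gpath (x i) (p i),
        forall i j, i != j -> [disjoint x i :: p i & x j :: p j],
        injective x /\ (forall i, x i \in A1),
        injective (fun i => last (x i) (p i)) /\
          (forall i, last (x i) (p i) \in A2)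
      & forall i, #|[set v in x i :: p i] :&: A1| = 1 /\
                  #|[set v in x i :: p i] :&: A2| = 1].

End Linkage.

(* Main.v *)
(** A system of disjoint paths from [X] onto [Y] is the same thing as a
    permutation of the vertices that maps [Y] onto [X] and sends every vertex
    outside [Y] to itself or to a neighbour: close each path into a cycle, and
    conversely follow the permutation from [X] until it hits [Y].
    Let [f] encode the linkage of [T1] and [T2], and [g] the one between
    k-subsets [X1] of [S1] and [X2] of [S2].  Iterating [g^-1 f] from the
    points of [X2] until either [T2] is hit or the next point is in [X2] gives
    disjoint orbit segments; since [T2] is smaller than [X2], some segment,
    starting at [s2] say, never meets [T2] and stops just before a return to
    [X2].  Replacing [f] by [g] along that segment frees [s2] and one vertex
    [s1] of [X1]. *)
Require Import Defs.
From mathcomp Require Import all_fingroup all_boot.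

Set Implicit Arguments.
Unset Strict Implicit.
Unset Printing Implicit Defensive.

Lemma next_path (T : eqType) (e : rel T) (x : T) (p : seq T) (u : T) :
    path e x p -> uniq (x :: p) -> u \in x :: p -> u != last x p ->
  e u (next (x :: p) u).
Proof.
move=> xp Uxp u_xp u_last.
(* Allowing every arc out of the last vertex turns the path into a cycle, and elsewhere [e'] is
   still [e]. *)
pose e' := [rel a b | e a b || (a == last x p)].
have: cycle e' (x :: p).
  rewrite /= rcons_path /= eqxx orbT andbT.
  by apply: sub_path xp => a b /= ->.
by move/next_cycle=> /(_ u u_xp) /=; rewrite (negPf u_last) orbF.
Qed.

Lemma fpath_sub_path (T : eqType) (f : T -> T) (e : rel T) (x : T) (p : seq T) :
  fpath f x p -> {in belast x p, forall u, e u (f u)} -> path e x p.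
Proof.
elim: p x => //= y p IHp x /andP[/eqP fx yp] xp.
rewrite -{1}fx xp ?mem_head //=; apply: IHp yp _ => u uyp.
by apply: xp; rewrite inE uyp orbT.
Qed.

Lemma next_last (T : eqType) (x : T) (p : seq T) :
  uniq (x :: p) -> next (x :: p) (last x p) = x.
Proof.
by move=> Uxp; rewrite next_nth mem_last index_last // nth_default.
Qed.

(** * Permutations built from cycles, and orbit segments cut at a set *)

Section Permutations.

Variable V : finType.
Implicit Types (s f g : {perm V}) (X Y : {set V}).

(** Disjointness makes the choice of the cycle through a vertex irrelevant, so turning back with
    [prev] inverts turning with [next]. *)
Lemma perm_of_cycles (I : finType) (c : I -> seq V) :
    (forall i, uniq (c i)) ->
    (forall i j, i != j -> [disjoint c i & c j]) ->
  exists s : {perm V},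
    (forall i, {in c i, s =1 next (c i)}) /\
    (forall v, (forall i, v \notin c i) -> s v = v).
Proof.
move=> Uc Dc.
pose turn (h : seq V -> V -> V) v :=
  if [pick i | v \in c i] is Some i then h (c i) v else v.
have turn_in h i v : v \in c i -> turn h v = h (c i) v.
  rewrite /turn => vi; case: pickP => [j vj|/(_ i)]; last by rewrite vi.
  have [->//|/Dc/disjointFr/(_ vi)] := eqVneq i j; by rewrite vj.
have turn_out h v : (forall i, v \notin c i) -> turn h v = v.
  by rewrite /turn => vN; case: pickP => // i; rewrite (negPf (vN i)).
have turnK : cancel (turn next) (turn prev).
  move=> v; case: (pickP (fun i => v \in c i)) => [i vi | vN].
    by rewrite (turn_in _ i) // (turn_in _ i) ?mem_next ?prev_next.
  by rewrite !turn_out // => i; rewrite vN.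
exists (perm (can_inj turnK)); split=> [i v vi | v vN]; rewrite permE.
  exact: turn_in.
exact: turn_out.
Qed.

(** If the orbit misses [Y], [find] returns its default, the length of the orbit. *)
Definition exit s Y x := find [in Y] (orbit s x).

(* Only meaningful when [s^-1 x] is in [Y], so that the orbit does meet [Y]. *)
Definition walk s Y x := traject s (s x) (exit s Y x).

Lemma mem_walk s Y x u :
  reflect (exists2 i, i <= exit s Y x & u = iter i s x) (u \in x :: walk s Y x).
Proof. exact: (@trajectP _ s x (exit s Y x).+1). Qed.

Lemma last_walk s Y x : last x (walk s Y x) = iter (exit s Y x) s x.
Proof. exact: last_traject. Qed.

Lemma walk_path s Y x : fpath s x (walk s Y x).
Proof. exact: fpath_traject. Qed.

Lemma iter_perm_inj s n : injective (iter n s).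
Proof. by elim: n => [|n IHn] x y //= /perm_inj/IHn. Qed.

Lemma exit_before s Y x i : i < exit s Y x -> iter i s x \notin Y.
Proof.
move=> lt_i; have := before_find x lt_i.
rewrite nth_traject => [/= ->//|].
by rewrite (leq_trans lt_i) // -(size_orbit s x) find_size.
Qed.

Section Entry.

Variables (s : {perm V}) (X Y : {set V}).
Hypothesis sXY : X \subset s @: Y.

(** The preimage of [x] lies in [Y] and on the cycle of [x], so the search succeeds within one
    turn. *)
Lemma exit_lt_order x : x \in X -> exit s Y x < order s x.
Proof.
move/(subsetP sXY)=> /imsetP[y yY ->].
rewrite -(size_orbit s) -has_find; apply/hasP; exists y => //.
by rewrite -fconnect_orbit fconnect_sym ?fconnect1 //; apply: perm_inj.
Qed.

Lemma exit_mem x : x \in X -> last x (walk s Y x) \in Y.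
Proof.
move=> xX; have lt_o := exit_lt_order xX.
have: has [in Y] (orbit s x) by rewrite has_find size_orbit.
by move/(nth_find x); rewrite nth_traject ?last_walk.
Qed.

Lemma walk_uniq x : x \in X -> uniq (x :: walk s Y x).
Proof.
move=> xX; have lt_o := exit_lt_order xX.
rewrite -[_ :: _]/(traject s x (exit s Y x).+1).
have := orbit_uniq s x; rewrite /orbit -(subnKC lt_o) trajectD cat_uniq.
by case/andP.
Qed.

Lemma walk_interior x u : u \in x :: walk s Y x -> u != last x (walk s Y x) ->
  u \notin Y.
Proof.
case/mem_walk=> i; rewrite leq_eqVlt last_walk => /predU1P[->->|lt_i ->] //.
  by rewrite eqxx.
by move=> _; apply: exit_before.
Qed.

(** Go back from [u] along both walks. If [x] is reached first, it is a later point of the walk from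
    [y]; the point just before it lies in [Y], where that walk should have stopped. *)
Lemma walk_inj x y u : x \in X -> y \in X ->
  u \in x :: walk s Y x -> u \in y :: walk s Y y -> x = y.
Proof.
move=> xX yX /mem_walk[i le_i ->] /mem_walk[j le_j].
wlog le_ij : x y i j xX yX le_i le_j / i <= j.
  move=> th; case/orP: (leq_total i j) => [ij|ji] E; first exact: th E.
  by apply/esym/(th y x j i).
rewrite -(subnKC le_ij) iterD => /iter_perm_inj xE.
case def_d: (j - i) xE => [|d] //= xE.
have /imsetP[z zY /eqP] := subsetP sXY x xX.
rewrite xE (inj_eq (@perm_inj _ s)) => /eqP zE.
suff: iter d s y \notin Y by rewrite zE zY.
by apply: exit_before; apply: leq_trans le_j; rewrite -def_d leq_subr.
Qed.

End Entry.

End Permutations.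

(** * Linkages as permutations, and the exchange *)

Section Linking.

Variables (V : finType) (e : rel V).
Implicit Types (s f g : {perm V}) (X Y : {set V}).

Definition linking s X Y :=
  s @: Y = X /\ forall v, v \notin Y -> s v = v \/ e v (s v).

Lemma linked_linking m (A1 A2 : {set V}) : linked e m A1 A2 ->
  exists s X Y,
    [/\ X \subset A1, Y \subset A2, #|X| = m, #|Y| = m & linking s X Y].
Proof.
case=> x [p [pP disp [injx xA] [injl lA] _]].
have Up i : uniq (x i :: p i) by have /andP[] := pP i.
have [s [s_in s_out]] := perm_of_cycles Up disp.
exists s, [set x i | i : 'I_m], [set last (x i) (p i) | i : 'I_m].
split; first by apply/subsetP=> _ /imsetP[i _ ->].
- by apply/subsetP=> _ /imsetP[i _ ->].
- by rewrite card_imset // card_ord.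
- by rewrite card_imset // card_ord.
split.
  rewrite -imset_comp; apply: eq_imset => i /=.
  by rewrite (s_in i) ?mem_last ?next_last.
move=> v vN; case: (pickP (fun i => v \in x i :: p i)) => [i vi | vout].
  right; rewrite (s_in i) //; have /andP[pi _] := pP i.
  apply: next_path => //; apply: contraNneq vN => ->.
  exact: imset_f.
by left; apply: s_out => i; rewrite vout.
Qed.

Lemma linking_linked s X Y : linking s X Y -> linked e #|X| X Y.
Proof.
case=> sYX s_step; have sXY : X \subset s @: Y by rewrite sYX.
pose x (i : 'I_#|X|) : V := enum_val i.
have xX i : x i \in X by apply: enum_valP.
have x_inj : injective x by apply: enum_val_inj.
have meet i j u : u \in x i :: walk s Y (x i) -> u \in x j :: walk s Y (x j) ->
  i = j by move=> ui uj; apply/x_inj/(walk_inj sXY (xX i) (xX j) ui uj).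
have lY i : last (x i) (walk s Y (x i)) \in Y by apply: exit_mem sXY _ (xX i).
exists x, (fun i => walk s Y (x i)); split=> //.
- move=> i; rewrite /gpath (walk_uniq sXY) ?xX // andbT.
  have := walk_uniq sXY (xX i); rewrite lastI rcons_uniq => /andP[lN _].
  apply: fpath_sub_path (walk_path s Y (x i)) _ => u uq.
  have u_last : u != last (x i) (walk s Y (x i)) by apply: contraNneq lN => <-.
  have ui := mem_belast uq.
  (* If [s] fixed [u], the whole walk would be the single point [u], which would then be its last
     vertex. *)
  have [su|//] := s_step u (walk_interior ui u_last).
  have /mem_walk[j _ uE] := ui; case/eqP: u_last.
  have iter_u n : iter n s u = u by elim: n => //= n ->.
  have <- : u = x i by apply: (@iter_perm_inj _ s j); rewrite iter_u.
  by rewrite last_walk iter_u.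
- move=> i j; apply: contraR => /pred0Pn[u /andP[ui uj]].
  by apply/eqP; apply: meet ui uj.
- split=> // i j E; apply: (meet i j (last (x i) (walk s Y (x i)))).
    exact: mem_last.
  by rewrite E mem_last.
move=> i; split; apply/eqP/cards1P.
  exists (x i); apply/setP=> u; rewrite !inE.
  apply/andP/eqP=> [[ui uX]|->]; last by rewrite eqxx xX.
  (* A point of [X] on this walk also starts its own walk, so the two starting points agree. *)
  by apply/esym/(walk_inj sXY (xX i) uX ui); rewrite inE eqxx.
exists (last (x i) (walk s Y (x i))); apply/setP=> u; rewrite !inE -in_cons.
apply/andP/eqP=> [[ui uY]|->]; last by rewrite mem_last lY.
by apply: contraTeq uY; apply: walk_interior.
Qed.

Lemma linking_exchange f g (T1 T2 X1 X2 : {set V}) :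
    linking f T1 T2 -> linking g X1 X2 -> #|T2| < #|X2| ->
  exists (s1 s2 : V) (h : {perm V}), [/\ s1 \in X1 :\: T1, s2 \in X2 :\: T2
    & linking h (T1 :|: [set s1]) (T2 :|: [set s2])].
Proof.
move=> [fT f_step] [gX g_step] ltTX.
(* Products of permutations apply the left factor first: [s u] is [g^-1 (f u)]. *)
pose s : {perm V} := (f * g^-1)%g.
have gs u : g (s u) = f u by rewrite /s permM permKV.
pose Y := T2 :|: s @^-1: X2.
have sX : X2 \subset s @: Y.
  apply/subsetP=> v vX; apply/imsetP; exists ((s^-1)%g v); rewrite ?permKV //.
  by rewrite !inE permKV vX orbT.
pose out a := last a (walk s Y a).
have out_inj : {in X2 &, injective out}.
  move=> a b aX bX E; apply: (walk_inj sX aX bX (mem_last _ _)).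
  by rewrite -/(out a) E mem_last.
(* Pigeonhole: otherwise [out] would inject [X2] into the smaller set [T2]. *)
have [a aX aT] : exists2 a, a \in X2 & out a \notin T2.
  apply/exists_inP; rewrite -negb_forall_in; apply: contraL ltTX.
  move/forall_inP=> outT; rewrite -leqNgt -(card_in_imset out_inj).
  by apply/subset_leq_card/subsetP=> _ /imsetP[a aX ->]; apply: outT.
have outX : s (out a) \in X2.
  by have := exit_mem sX aX; rewrite !inE -/(out a) (negPf aT).
pose c := a :: walk s Y a; have Uc : uniq c by apply: walk_uniq sX _ aX.
have cT u : u \in c -> u \notin T2.
  move=> uc; have [->//|/(walk_interior uc)] := eqVneq u (out a).
  by rewrite !inE => /norP[].
(* [t] rotates the single cycle [c]. Then [t^-1 * f] agrees with [f] off [c] and with [g] on [c]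
   except at [a], which it sends to [f (out a)]. *)
have [||t [t_in t_out]] := @perm_of_cycles V unit (fun=> c).
- by [].
- by case=> [] [].
have t_last : t (out a) = a by rewrite (t_in tt) ?mem_last ?next_last.
have t_fix v : v \notin c -> t v = v by move=> vN; apply: t_out.
have ht v : (t^-1 * f)%g (t v) = f v by rewrite permM permK.
(* The vertex [f (out a)] is in [X1] because it equals [g (s (out a))] with [s (out a)] in [X2]. *)
exists (f (out a)), a, (t^-1 * f)%g; split.
- rewrite inE -{2}gs -gX imset_f // andbT -fT.
  by rewrite mem_imset ?aT //; apply: perm_inj.
- by rewrite inE aX cT ?mem_head.
split.
  rewrite imsetU imset_set1 -(ht (out a)) t_last -fT; congr (_ :|: _).
  apply: eq_in_imset => v vT; rewrite -{1}(t_fix v) ?ht //.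
  by apply: contraL vT; apply: cT.
move=> w; rewrite -[w](permKV t); move: (_ w) => u; rewrite ht !inE.
case/norP=> tuT tua; have [uc|uNc] := boolP (u \in c); last first.
  by move: tuT; rewrite t_fix //; apply: f_step.
have uo : u != out a by apply: contraNneq tua => ->; rewrite t_last.
(* Before its end the segment is followed by [s] and [t] alike, so the image of [t u] is
   [f u = g (s u)]; as [u] is not in [Y], [s u] avoids [X2] and [g] makes a legal step. *)
have <- : s u = t u.
  by rewrite (t_in tt) //; apply/eqP/(next_path (walk_path s Y a) Uc uc uo).
rewrite -gs; apply: g_step.
by have := walk_interior uc uo; rewrite !inE => /norP[].
Qed.

End Linking.

Theorem theorem2p2 (V : finType) (e : rel V)
    (e_sym : symmetric e) (e_irr : irreflexive e)
    (k : nat) (k_ge1 : 1 <= k)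
    (S1 S2 : {set V}) (disS : [disjoint S1 & S2])
    (linkS : linked e k S1 S2)
    (T1 T2 : {set V}) (sT1 : T1 \subset S1) (sT2 : T2 \subset S2)
    (cardT1 : #|T1| = k - 1) (cardT2 : #|T2| = k - 1)
    (linkT : linked e (k - 1) T1 T2) :
  exists s1 s2 : V,
    [/\ s1 \in S1 :\: T1,
        s2 \in S2 :\: T2
      & linked e k (T1 :|: [set s1]) (T2 :|: [set s2])].
Proof.
have [g [X1 [X2 [sX1 sX2 _ cX2 gP]]]] := linked_linking linkS.
have [f [Z1 [Z2 [sZ1 sZ2 cZ1 cZ2 fP]]]] := linked_linking linkT.
(* A linkage of size [k - 1] uses all of [T1] and [T2]. *)
have eqZ1 : Z1 = T1 by apply/eqP; rewrite eqEcard sZ1 cardT1 cZ1 /=.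
have eqZ2 : Z2 = T2 by apply/eqP; rewrite eqEcard sZ2 cardT2 cZ2 /=.
subst Z1 Z2.
have ltTX : #|T2| < #|X2| by rewrite cX2 cardT2 subn1 prednK.
have [s1 [s2 [h [/setDP[s1X s1T] /setDP[s2X s2T] hP]]]] :=
  linking_exchange fP gP ltTX.
exists s1, s2; split.
- by rewrite inE s1T (subsetP sX1).
- by rewrite inE s2T (subsetP sX2).
suff cardU : #|T1 :|: [set s1]| = k.
  by rewrite -[k in linked e k]cardU; apply: linking_linked hP.
by rewrite setUC cardsU1 s1T cardT1 add1n subn1 prednK.
Qed.
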